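(* Let $T\subseteq\omega^{<\omega_1}$ be an Aronszajn tree and let $\{A_\sigma:\sigma\in T\}\subseteq[\omega]^\omega$ be such that $A_\tau\subseteq^* A_\sigma$ whenever $\sigma\subseteq\tau\in T$, and $\{A_\sigma:\sigma\in T_\alpha\}$ is a partition of $\omega$ for every $\alpha<\omega_1$. Let $3\leq k<\omega$. For $\alpha<\omega_1$ let $X_\alpha=\bigvee_{\sigma\in T_\alpha}\omega^{k-1}\times A_\sigma$ and for $0<\alpha<\omega_1$ let $Y_\alpha=(\bigwedge_{\beta<\alpha}X_\beta)\setminus X_\alpha$, computed in $\mathcal{P}(\omega^k)/\mathcal{NC}^k$ (these suprema and infima exist). Then (1) $\{X_\alpha:\alpha<\omega_1\}$ is a tower in $\mathcal{P}(\omega^k)/\mathcal{NC}^k$, and (2) $\{Y_\alpha:0<\alpha<\omega_1\}$ is a partition (an $\mathcal{NC}^k$-mad family) in $\mathcal{P}(\omega^k)/\mathcal{NC}^k$.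
   Context: A tree $T\subseteq\omega^{<\omega_1}$ is a set of functions from countable ordinals to $\omega$ closed under restriction; $T_\alpha=\{\sigma\in T:\mathrm{dom}(\sigma)=\alpha\}$; $T$ is Aronszajn if $0<|T_\alpha|\leq\omega$ for all $\alpha<\omega_1$ and there is no $f:\omega_1\to\omega$ with $f\upharpoonright\alpha\in T$ for all $\alpha$. The ideals $\mathrm{fin}^k$ on $\omega^k$: $\mathrm{fin}^1$ is the ideal of finite subsets of $\omega$, and $\mathrm{fin}^k=\{A\subseteq\omega^k: A(n)\in\mathrm{fin}^{k-1}\text{ for all but finitely many } n\}$, with $A(n)=\{\bar x\in\omega^{k-1}:(n)^\frown\bar x\in A\}$; $A\subseteq_{\mathrm{fin}^k}B$ iff $A\setminus B\in\mathrm{fin}^k$. For $k\geq2$, $\mathcal{NC}^k=\{A\subseteq\omega^k:\ \text{for all }(A_0,\dots,A_{k-2})\in([\omega]^\omega)^{k-1},\ \text{for all but finitely many } n,\ \prod_{i<k-1}A_i\not\subseteq_{\mathrm{fin}^{k-1}}A(n)\}$, an ideal. A tower in the quotient is a family of nonzero elements (sets not in $\mathcal{NC}^k$) well-ordered by reverse inclusion modulo $\mathcal{NC}^k$ with no nonzero lower bound. An $\mathcal{NC}^k$-mad family (partition) is a maximal family of sets not in $\mathcal{NC}^k$ whose pairwise intersections lie in $\mathcal{NC}^k$.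
   Formalization: In (2) the mad family consists of the nonzero Y_α only (all Y_α are still pairwise disjoint modulo NC^k): some Y_α may be zero, e.g. if T_0 and T_1 are singletons then X_0 = X_1 = ω^k and Y_1 is zero, so the full family need not consist of nonzero sets. *)

(* Defs.v *)
From mathcomp Require Import all_boot all_order all_classical.

Set Implicit Arguments.
Unset Strict Implicit.
Unset Printing Implicit Defensive.

Local Open Scope order_scope.
Local Open Scope classical_set_scope.

Section Trees.
Context {d : Order.disp_t} {W : orderType d}.

Definition seg (a : W) : set W := [set b | b < a].

(* A well-order that is uncountable and has countable proper initial segments
   has order type omega_1; the elements of W then stand for the countable
   ordinals, and [seg a] for the ordinal a as a von Neumann ordinal. *)
Definition is_omega1 : Prop :=
  [/\ forall S : set W, S !=set0 -> exists2 m, S m & forall x, S x -> m <= x,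
      forall a : W, countable (seg a)
    & ~ countable [set: W]].

(* A function from a countable ordinal to omega is a partial function on W
   whose domain is some [seg a]. *)
Definition pfun : Type := W -> option nat.

Definition dom (s : pfun) : set W := [set b | s b <> None].

Definition restr (s : pfun) (a : W) : pfun :=
  fun b => if b < a then s b else None.

(* s is included in t, as graphs *)
Definition extended_by (s t : pfun) : Prop :=
  forall b n, s b = Some n -> t b = Some n.

Definition level (T : set pfun) (a : W) : set pfun :=
  [set s | T s /\ dom s = seg a].

Definition is_tree (T : set pfun) : Prop :=
  (forall s, T s -> exists a, dom s = seg a) /\
  (forall s a, T s -> T (restr s a)).

Definition aronszajn (T : set pfun) : Prop :=
  [/\ is_tree T,
      forall a, level T a !=set0 /\ countable (level T a)
    & ~ exists f : W -> nat, forall a, T (restr (fun b => Some (f b)) a)].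

End Trees.

Arguments is_omega1 {d} W.
Arguments pfun {d} W.

Definition almost_sub (B A : set nat) : Prop := finite_set (B `\` A).

Definition almost_all (P : nat -> Prop) : Prop := finite_set [set n | ~ P n].

Definition slice {k : nat} (A : set (k.+1.-tuple nat)) (n : nat) :
    set (k.-tuple nat) :=
  [set x : k.-tuple nat | A (cons_tuple n x)].

(* The value at 0 is a placeholder: fin^k is only meant for k >= 1. *)
Fixpoint fin_ideal (k : nat) : set (set (k.-tuple nat)) :=
  match k with
  | 0 => [set set0]
  | m.+1 =>
      match m with
      | 0 => [set A : set (m.+1.-tuple nat) | finite_set A]
      | _.+1 => [set A : set (m.+1.-tuple nat) |
                  almost_all (fun n => @fin_ideal m (slice A n))]
      end
  end.

Arguments fin_ideal : clear implicits.

Definition box {k : nat} (B : 'I_k -> set nat) : set (k.-tuple nat) :=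
  [set x : k.-tuple nat | forall i, B i (tnth x i)].

(* The values at 0 and 1 are placeholders: NC^k is only meant for k >= 2. *)
Definition NC (k : nat) : set (set (k.-tuple nat)) :=
  match k with
  | 0 => [set set0]
  | m.+1 => [set A : set (m.+1.-tuple nat) |
      forall B : 'I_m -> set nat, (forall i, infinite_set (B i)) ->
        almost_all (fun n => ~ fin_ideal m (box B `\` slice A n))]
  end.

Arguments NC : clear implicits.

(* omega^(k-1) x A, for k >= 1 *)
Definition cylinder (k : nat) (A : set nat) : set (k.-tuple nat) :=
  [set x : k.-tuple nat | A (last 0 x)].

Arguments cylinder : clear implicits.

(* Elements of the quotient P(U)/I are handled through representatives. *)
Section Quotient.
Context {U : Type} (I : set (set U)).

Definition le_mod (A B : set U) : Prop := I (A `\` B).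

Definition eq_mod (A B : set U) : Prop := le_mod A B /\ le_mod B A.

Definition is_sup_mod (F : set (set U)) (S : set U) : Prop :=
  (forall A, F A -> le_mod A S) /\
  (forall C, (forall A, F A -> le_mod A C) -> le_mod S C).

Definition is_inf_mod (F : set (set U)) (S : set U) : Prop :=
  (forall A, F A -> le_mod S A) /\
  (forall C, (forall A, F A -> le_mod C A) -> le_mod C S).

Definition well_ordered_rev (F : set (set U)) : Prop :=
  forall G : set (set U), G `<=` F -> G !=set0 ->
    exists2 A, G A & forall B, G B -> le_mod B A.

Definition is_tower (F : set (set U)) : Prop :=
  [/\ forall A, F A -> ~ I A,
      well_ordered_rev F
    & ~ exists2 P, ~ I P & forall A, F A -> le_mod P A].

Definition is_ad (F : set (set U)) : Prop :=
  (forall A, F A -> ~ I A) /\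
  (forall A B, F A -> F B -> A <> B -> I (A `&` B)).

Definition is_mad (F : set (set U)) : Prop :=
  is_ad F /\ forall G, is_ad G -> F `<=` G -> G = F.

(* Members equal to zero in P(U)/I are ignored. They do occur for the family
   Y_a = (inf_(b < a) X_b) \ X_a of an Aronszajn tree: if levels 0 and 1 have a
   single node each, then X_0 = X_1 = omega^k, so that Y_1 is zero. *)
Definition is_partition_mod {J : Type} (D : set J) (Y : J -> set U) : Prop :=
  (forall a b, D a -> D b -> a <> b -> I (Y a `&` Y b)) /\
  is_mad [set Y a | a in [set a | D a /\ ~ I (Y a)]].

End Quotient.

(* Main.v *)
Require Import Defs.
From mathcomp Require Import all_boot all_order all_classical.
(** A set is outside [NC k] iff, modulo [fin_ideal], infinitely many of its
    slices contain one fixed box with infinite sides; so comparisons modulo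
    [NC k] can be tested on boxes, and only the last side of a box matters for
    cylinders.  Let [F a i] enumerate the sets of level [a] and let
    [W a m := F a 0 ∪ .. ∪ F a m].  Then [X a] is [{x | W a x_0 contains
    x_(k-1)}]: a box below it has its last side almost inside some [W a m].  The
    infimum of [X (b 0), X (b 1), ..] is [{x | for all j <= x_0, W (b j) x_1
    contains x_(k-1)}]; it needs the three distinct coordinates 0, 1 and k-1.

    If a nonzero element were below every [X a], some infinite set [B] would be,
    on every level, almost inside finitely many [A s].  A nonprincipal
    ultrafilter containing [B] then selects exactly one node on each level, and
    these nodes form a cofinal branch of the Aronszajn tree.  So a nonzero [P]
    has a least [a] with [P] not below [X a]; [a] is not minimal, and [P] meets
    [Y a]. *)

Set Implicit Arguments.
Unset Strict Implicit.
Unset Printing Implicit Defensive.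


Local Open Scope classical_set_scope.

(** * Almost inclusion, ultrafilters and pseudo-intersections on the naturals *)

Lemma finite_natP (S : set nat) :
  finite_set S <-> exists m, forall n, S n -> n < m.
Proof.
split=> [/finite_seqP[s ->]|[m Sm]]; last exact: sub_finite_set Sm (finite_II m).
by exists (\max_(i <- s) i).+1 => n /= ns; rewrite ltnS; apply: leq_bigmax_seq.
Qed.

Lemma infinite_natP (S : set nat) :
  infinite_set S <-> forall m, exists2 n, m <= n & S n.
Proof.
split=> [Sinf m|Sub /finite_natP[m Sm]].
  apply: contrapT => nS; apply: Sinf; apply/finite_natP; exists m => n Sn.
  by rewrite ltnNge; apply/negP => mn; apply: nS; exists n.
by have [n mn /Sm] := Sub m; rewrite ltnNge mn.
Qed.

Lemma almost_allP (P : nat -> Prop) :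
  almost_all P <-> exists m, forall n, m <= n -> P n.
Proof.
split=> [/finite_natP[m Pm]|[m Pm]].
  exists m => n mn; apply: contrapT => /Pm; by rewrite ltnNge mn.
by apply/finite_natP; exists m => n nP; rewrite ltnNge; apply/negP => /Pm.
Qed.

Lemma almost_subP (B A : set nat) :
  almost_sub B A <-> exists m, forall n, m <= n -> B n -> A n.
Proof.
split=> [/finite_natP[m Pm]|[m Pm]].
  exists m => n mn Bn; apply: contrapT => nA.
  by have := Pm n (conj Bn nA); rewrite ltnNge mn.
apply/finite_natP; exists m => n [Bn nA]; rewrite ltnNge.
by apply/negP => mn; apply/nA/Pm.
Qed.

Lemma subset_almost_sub (B A : set nat) : B `<=` A -> almost_sub B A.
Proof. by move=> BA; apply/almost_subP; exists 0 => n _ /BA. Qed.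

(** Pick [g m >= m] in the first [m + 1] sets: the range of [g] is unbounded, and only the values
    [g m] with [m < j] can fall outside [E j]. *)
Lemma pseudo_intersection (E : nat -> set nat) :
    (forall m, exists2 x, m <= x & forall j, j <= m -> E j x) ->
  exists B, [/\ infinite_set B, B `<=` E 0 & forall j, almost_sub B (E j)].
Proof.
move=> EP.
have [g gP] := choice (fun m => let: ex_intro2 x a b := EP m in
  ex_intro (fun x => m <= x /\ forall j, j <= m -> E j x) x (conj a b)).
exists (range g); split=> [|_ [m _ <-]|j].
- apply/infinite_natP => m; exists (g m); first by have [] := gP m.
  by exists m.
- by have [_] := gP m; apply.
- apply/finite_natP; exists (\max_(m < j) g m).+1 => _ [[m _ <-] nE].
  have mj : m < j.
    by rewrite ltnNge; apply/negP => jm; apply: nE; have [_] := gP m; apply.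
  by rewrite ltnS (leq_bigmax (Ordinal mj)).
Qed.

(** The sets almost containing [B] form a filter, proper because [B] is infinite; any ultrafilter
    extending it will do. *)
Lemma ultrafilter_of_infinite (B : set nat) : infinite_set B ->
  exists V, UltraFilter V /\ forall S, almost_sub B S -> V S.
Proof.
move=> Binf; apply: (@ultraFilterLemma _ (almost_sub B)).
apply: Build_ProperFilter => [|].
  by rewrite /almost_sub setD0 => /Binf.
split=> [|P Q BP BQ|P Q PQ].
- by apply: subset_almost_sub.
- by rewrite /almost_sub setDIr finite_setU.
- by apply: sub_finite_set => x [Bx nQ]; split=> // /PQ.
Qed.

Lemma ultra_infinite (B : set nat) (V : set_system nat) : UltraFilter V ->
  (forall S, almost_sub B S -> V S) -> forall S, V S -> infinite_set S.
Proof.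
move=> UV BV S VS Sfin; have : V (~` S).
  by apply: BV; apply: sub_finite_set Sfin => x [_ /contrapT].
by move=> /(filterI VS); rewrite setICr; apply: filter_not_empty.
Qed.

(** An ultrafilter containing [B] chooses between each [C j] and its complement. Finitely many
    choices meet [B] in an infinite set, so all of them have a common pseudo-intersection inside
    [B]. *)
Lemma decide_nat (J : countType) (B : set nat) (C : J -> set nat) :
  infinite_set B ->
  exists B', [/\ infinite_set B', B' `<=` B &
    forall j, almost_sub B' (C j) \/ almost_sub B' (~` C j)].
Proof.
move=> Binf; pose D n := if unpickle n is Some j then C j else setT.
have [V [UV BV]] := ultrafilter_of_infinite Binf.
pose E n := if `[< V (D n) >] then D n else ~` D n.
have VE n : V (E n).
  by rewrite /E; case: asboolP => // nV; case: (in_ultra_setVsetC (D n) UV).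
have VF m : V [set x | forall j, j <= m -> E j x].
  elim: m => [|m IH].
    by apply: filterS (VE 0) => x Ex j; rewrite leqn0 => /eqP ->.
  apply: filterS (filterI (VE m.+1) IH) => x [Ex IHx] j.
  by rewrite leq_eqVlt ltnS => /orP[/eqP ->//|/IHx].
have VB : V B by apply/BV/subset_almost_sub.
have [m|B' [B'inf B'B B'E]] := @pseudo_intersection (fun j => B `&` E j).
  have [x mx [Bx Ex]] :=
    (infinite_natP _).1 (ultra_infinite UV BV (filterI VB (VF m))) m.
  by exists x => // j /Ex.
exists B'; split=> // [x /B'B[]//|j].
have -> : C j = D (pickle j) by rewrite /D pickleK.
move: (pickle j) => n; have : almost_sub B' (E n).
  by apply: sub_finite_set (B'E n) => x [? nE]; split=> // -[].
by rewrite /E; case: asboolP; [left|right].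
Qed.

(** * The iterated ideals of finite sets, tested on boxes *)

Lemma cons_tuple_eta k (x : k.+1.-tuple nat) :
  cons_tuple (thead x) (behead_tuple x) = x.
Proof. by rewrite [RHS]tuple_eta; apply/val_inj. Qed.

(* This covers [k = 0] too, so inductions on dimension can start at the
   placeholder [fin_ideal 0]. *)
Lemma fin_idealS k (A : set (k.+1.-tuple nat)) :
  fin_ideal k.+1 A <-> exists m, forall n, m <= n -> fin_ideal k (slice A n).
Proof.
rewrite -almost_allP; case: k A => [|k] A //=; rewrite /almost_all.
have sliceN0 x : A x -> slice A (thead x) <> set0.
  move=> Ax /seteqP[/(_ (behead_tuple x)) + _]; apply.
  by rewrite /slice /= cons_tuple_eta.
(* Only dimension one is left: the exceptional [n] are the first entries of members of [A], and a
   1-tuple is determined by its entry. *)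
split=> Afin.
  have -> : [set n | ~ slice A n = set0] = (fun x => thead x) @` A.
    apply/seteqP; split=> [n /= /eqP/set0P[x Ax]|_ [x /sliceN0 ? <-]//].
    by exists (cons_tuple n x).
  exact: finite_image.
apply: (sub_finite_set _ (finite_image (fun n => [tuple n]) Afin)) => x Ax.
exists (thead x); first exact: sliceN0.
by apply/val_inj; case: x Ax => -[|? [|]].
Qed.

Lemma fin_ideal0 k : fin_ideal k set0.
Proof.
elim: k => [//|k IH]; apply/fin_idealS; exists 0 => n _.
by rewrite (_ : slice set0 n = set0).
Qed.

Lemma fin_ideal_sub k (A B : set (k.-tuple nat)) :
  A `<=` B -> fin_ideal k B -> fin_ideal k A.
Proof.
elim: k A B => [|k IH] A B AB; first by move=> /= B0; rewrite -subset0 -B0.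
move=> /fin_idealS[m Bm]; apply/fin_idealS; exists m => n /Bm.
by apply: IH => x /AB.
Qed.

Lemma fin_idealU k (A B : set (k.-tuple nat)) :
  fin_ideal k A -> fin_ideal k B -> fin_ideal k (A `|` B).
Proof.
elim: k A B => [|k IH] A B; first by move=> /= -> ->; rewrite setU0.
move=> /fin_idealS[m Am] /fin_idealS[m' Bm]; apply/fin_idealS.
exists (maxn m m') => n; rewrite geq_max => /andP[/Am An /Bm Bn].
by apply: fin_ideal_sub (IH _ _ An Bn) => x.
Qed.

Lemma box_cons k (B : 'I_k.+1 -> set nat) n (x : k.-tuple nat) :
  box B (cons_tuple n x) <-> B ord0 n /\ box (fun i => B (lift ord0 i)) x.
Proof.
split=> [Bx|[B0 Bx] i].
  split; first by have := Bx ord0; rewrite tnth0.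
  by move=> i; have := Bx (lift ord0 i); rewrite tnthS.
by case: (unliftP ord0 i) => [j ->|->]; rewrite ?tnthS ?tnth0 //; apply: Bx.
Qed.

Lemma box_notin_fin k (B : 'I_k -> set nat) :
  (forall i, infinite_set (B i)) -> ~ fin_ideal k (box B).
Proof.
elim: k B => [|k IH] B Binf.
  by move/seteqP => [/(_ [tuple]) + _]; apply=> -[].
move=> /fin_idealS[m Bm]; have [n /Bm Bn B0n] := (infinite_natP _).1 (Binf ord0) m.
apply: (IH (fun i => B (lift ord0 i))) => //.
by apply: fin_ideal_sub Bn => x Bx; apply/box_cons.
Qed.

Lemma fin_slice_boxD k (B : 'I_k.+1 -> set nat) (C : set (k.+1.-tuple nat)) n :
  (B ord0 n -> fin_ideal k (box (fun i => B (lift ord0 i)) `\` slice C n)) ->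
  fin_ideal k (slice (box B `\` C) n).
Proof.
have [B0 /(_ B0)|nB0 _] := pselect (B ord0 n).
  by apply: fin_ideal_sub => x [/box_cons[_ Bx]].
apply: fin_ideal_sub (fin_ideal0 k) => x [/box_cons[/nB0]].
by [].
Qed.

Lemma cylinder_cons k (D : set nat) n (x : k.+1.-tuple nat) :
  cylinder k.+2 D (cons_tuple n x) = cylinder k.+1 D x.
Proof. by case/tupleP: x. Qed.

Lemma slice_cylinder k (D : set nat) n :
  slice (cylinder k.+2 D) n = cylinder k.+1 D.
Proof. by apply/funext => x; apply: cylinder_cons. Qed.

(** All slices of a cylinder agree, so the induction passes through every coordinate but the last,
    where finitely many exceptions are allowed. *)
Lemma fin_boxD_cylinder k (B : 'I_k.+1 -> set nat) (D : set nat) :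
  almost_sub (B ord_max) D -> fin_ideal k.+1 (box B `\` cylinder k.+1 D).
Proof.
elim: k B => [|k IH] B BD; apply/fin_idealS.
  have /almost_subP[m Bm] := BD; exists m => n mn; apply: fin_slice_boxD.
  rewrite -[ord0](_ : ord_max = _) => [Bn|]; last exact/val_inj.
  apply: fin_ideal_sub (fin_ideal0 _) => x [_]; apply.
  by rewrite (tuple0 x) /slice /cylinder /=; apply: Bm.
exists 0 => n _; apply: fin_slice_boxD => _; rewrite slice_cylinder; apply: IH.
by rewrite (_ : lift ord0 ord_max = ord_max) //; apply/val_inj.
Qed.

(** Shrinking the last side of a box is the only refinement needed to handle cylinders. *)
Definition set_last k (B : 'I_k.+1 -> set nat) (D : set nat) (i : 'I_k.+1) :=
  if i == ord_max then D else B i.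

Lemma set_last_max k (B : 'I_k.+1 -> set nat) D : set_last B D ord_max = D.
Proof. by rewrite /set_last eqxx. Qed.

Lemma set_last_infinite k (B : 'I_k.+1 -> set nat) D :
    (forall i, infinite_set (B i)) -> infinite_set D ->
  forall i, infinite_set (set_last B D i).
Proof. by move=> Binf Dinf i; rewrite /set_last; case: ifP. Qed.

Lemma box_set_last k (B : 'I_k.+1 -> set nat) D : D `<=` B ord_max ->
  box (set_last B D) `<=` box B `&` cylinder k.+1 D.
Proof.
move=> DB x Bx; split=> [i|].
  by have := Bx i; rewrite /set_last; case: eqP => // -> /DB.
have := Bx ord_max; rewrite set_last_max (tnth_nth 0) /cylinder /=.
by rewrite -nth_last size_tuple.
Qed.

(** Otherwise the box with last side [B ord_max] minus [D] still has infinite sides, yet lies in the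
    small difference. *)
Lemma almost_sub_of_boxD_cylinder k (B : 'I_k.+1 -> set nat) (D : set nat) :
    (forall i, infinite_set (B i)) ->
  fin_ideal k.+1 (box B `\` cylinder k.+1 D) -> almost_sub (B ord_max) D.
Proof.
move=> Binf BDfin; apply: contrapT => nBD.
apply: (@box_notin_fin _ (set_last B (B ord_max `\` D))).
  exact: set_last_infinite.
apply: fin_ideal_sub BDfin => x /box_set_last[|Bx [_ nD]]; last by split.
by move=> n [].
Qed.

(** Induction on dimension; keeping a countable family [C] in the statement lets one smaller box
    decide all slices of all the sets at once. *)
Lemma decide_box k (J : countType) (B : 'I_k -> set nat)
    (C : J -> set (k.-tuple nat)) : (forall i, infinite_set (B i)) ->
  exists B' : 'I_k -> set nat,
    [/\ forall i, infinite_set (B' i), forall i, B' i `<=` B i &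
      forall j, fin_ideal k (box B' `\` C j) \/
                fin_ideal k (box B' `\` ~` C j)].
Proof.
elim: k J B C => [|k IH] J B C Binf.
  exists B; split=> [//|i //|j]; have [Cj|nCj] := pselect (C j [tuple]).
    by left; apply: fin_ideal_sub (fin_ideal0 _) => x []; rewrite (tuple0 x).
  right; apply: fin_ideal_sub (fin_ideal0 _) => x [_]; apply.
  by rewrite (tuple0 x).
have [//|B1 [B1inf B1B B1C]] := IH (J * nat)%type (fun i => B (lift ord0 i))
  (fun p => slice (C p.1) p.2).
(* The first side is thinned so that, for each [j], almost all its elements agree on which way [B1]
   decides the slice of [C j]. *)
have [B0 [B0inf B0B B0C]] := decide_nat
  (fun j => [set n | fin_ideal k (box B1 `\` slice (C j) n)]) (Binf ord0).
pose B' i := if unlift ord0 i is Some j then B1 j else B0.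
have B'0 : B' ord0 = B0 by rewrite /B' unlift_none.
have B'S : (fun i => B' (lift ord0 i)) = B1.
  by apply/funext => i; rewrite /B' liftK.
exists B'; split=> [i|i|j].
- by rewrite /B'; case: unlift.
- by rewrite /B'; case: unliftP => [j ->|->].
- case: (B0C j) => /almost_subP[m mP]; [left|right];
    apply/fin_idealS; exists m => n /mP; rewrite -B'0 => nP;
    apply: fin_slice_boxD => /nP; rewrite B'S //.
  by case: (B1C (j, n)).
Qed.

(** * The ideal [NC] and cylinders in its quotient *)

Lemma NCP k (A : set (k.+1.-tuple nat)) :
  NC k.+1 A <-> forall B : 'I_k -> set nat, (forall i, infinite_set (B i)) ->
    exists m, forall n, m <= n -> ~ fin_ideal k (box B `\` slice A n).
Proof. by split=> NCA B /NCA/almost_allP. Qed.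

Lemma not_NCP k (A : set (k.+1.-tuple nat)) :
  ~ NC k.+1 A <-> exists B : 'I_k -> set nat, (forall i, infinite_set (B i)) /\
    infinite_set [set n | fin_ideal k (box B `\` slice A n)].
Proof.
split=> [nA|[B [Binf Ninf]] NCA].
  apply: contrapT => nB; apply: nA => B Binf; apply: contrapT => Ninf.
  apply: nB; exists B; split=> // Nfin; apply: Ninf.
  by apply: sub_finite_set Nfin => n /contrapT.
apply: Ninf; apply: sub_finite_set (NCA B Binf) => n /= Bn.
exact.
Qed.

Lemma NC_sub k (A B : set (k.+1.-tuple nat)) :
  A `<=` B -> NC k.+1 B -> NC k.+1 A.
Proof.
move=> AB /NCP NB; apply/NCP => D /NB[m mP]; exists m => n /mP + DA; apply.
by apply: fin_ideal_sub DA => x [Dx nB]; split=> // /AB.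
Qed.

(* A box refined so as to decide every slice of [A] shows that [NC] is closed
   under finite unions. *)
Lemma NCU k (A B : set (k.+1.-tuple nat)) :
  NC k.+1 A -> NC k.+1 B -> NC k.+1 (A `|` B).
Proof.
move=> /NCP NA /NCP NB; apply: contrapT => /not_NCP[D [Dinf Ninf]].
have [D' [D'inf D'D D'A]] := decide_box (slice A) Dinf.
have [m mA] := NA _ D'inf; have [m' mB] := NB _ D'inf.
have [n] := (infinite_natP _).1 Ninf (maxn m m').
rewrite geq_max => /andP[/mA nA /mB nB] Dn.
(* [D'] is not almost inside the slice of [A], so it almost avoids it; being a refinement of [D], it
   is then almost inside the slice of [B]. *)
case: (D'A n) => // D'nA; apply: nB.
apply: fin_ideal_sub (fin_idealU D'nA Dn) => x [D'x nBx].
have [Ax|nAx] := pselect (slice A n x); first by left; split=> // /(_ Ax).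
by right; split=> [i|[]//]; apply: D'D.
Qed.

Lemma le_mod_NC_trans k (A B C : set (k.+1.-tuple nat)) :
  le_mod (NC k.+1) A B -> le_mod (NC k.+1) B C -> le_mod (NC k.+1) A C.
Proof.
move=> AB BC; apply: NC_sub (NCU AB BC) => x [Ax nC].
by have [|] := pselect (B x); [right|left].
Qed.

Lemma subset_le_mod_NC k (A B : set (k.+1.-tuple nat)) :
  A `<=` B -> le_mod (NC k.+1) A B.
Proof.
move=> AB; apply/NCP => D Dinf; exists 0 => n _ Dn.
apply: (box_notin_fin Dinf); apply: fin_ideal_sub Dn => x Dx.
by split=> // -[/AB].
Qed.

(** The box witnessing that [P] is nonzero stays a witness after its last side is cut down to
    [D]. *)
Lemma pos_cylinder k (P : set (k.+2.-tuple nat)) (B : 'I_k.+1 -> set nat) D :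
    (forall i, infinite_set (B i)) ->
    infinite_set [set n | fin_ideal k.+1 (box B `\` slice P n)] ->
    infinite_set (B ord_max `&` D) ->
  ~ NC k.+2 (P `&` cylinder k.+2 D).
Proof.
move=> Binf Ninf Dinf; apply/not_NCP.
exists (set_last B (B ord_max `&` D)); split; first exact: set_last_infinite.
apply: sub_infinite_set Ninf => n; apply: fin_ideal_sub => x [].
case/box_set_last => [y []//|Bx [_ Dx]] nP; split=> // Px; apply: nP; split=> //.
by rewrite cylinder_cons.
Qed.

Lemma cylinder_pos k (D : set nat) : infinite_set D -> ~ NC k.+2 (cylinder k.+2 D).
Proof.
move=> Dinf; rewrite -[cylinder _ _]setTI.
apply: (@pos_cylinder _ _ (fun=> setT)) => [_||]; last by rewrite setTI.
  exact: infinite_nat.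
apply: sub_infinite_set infinite_nat => n _.
by apply: fin_ideal_sub (fin_ideal0 _) => x [_]; apply.
Qed.

Lemma cylinder_le_mod k (D E : set nat) : almost_sub D E ->
  le_mod (NC k.+2) (cylinder k.+2 D) (cylinder k.+2 E).
Proof.
move=> DE; apply/NCP => B Binf; exists 0 => n _ Bn.
have : almost_sub (B ord_max) (D `\` E).
  apply: almost_sub_of_boxD_cylinder => //; apply: fin_ideal_sub Bn => x [Bx nx].
  by split=> // -[]; rewrite !cylinder_cons => Dx Ex; apply: nx.
rewrite /almost_sub setDE => Bfin; apply: (Binf ord_max).
apply: sub_finite_set (_ : finite_set ((B ord_max `\` (D `\` E)) `|` (D `\` E))).
  by move=> x Bx; have [|] := pselect ((D `\` E) x); [right|left].
by rewrite finite_setU.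
Qed.

(** * Explicit suprema of cylinders and infima of such suprema *)

Definition initial_union (F : nat -> set nat) (n : nat) : set nat :=
  [set x | exists2 i, i <= n & F i x].

Lemma ultra_initial_union (V : set_system nat) F n : UltraFilter V ->
  V (initial_union F n) -> exists i, V (F i).
Proof.
move=> UV; apply: contraPP => nF VF.
have : V [set x | forall i, i <= n -> ~ F i x].
  elim: n {VF} => [|n IH].
    case: (in_ultra_setVsetC (F 0) UV) => [VF|]; first by case: nF; exists 0.
    by apply: filterS => x Fx i; rewrite leqn0 => /eqP ->.
  case: (in_ultra_setVsetC (F n.+1) UV) => [VF|/(filterI IH)].
    by case: nF; exists n.+1.
  apply: filterS => x [IHx Fx] i.
  by rewrite leq_eqVlt ltnS => /orP[/eqP ->//|/IHx].
move=> /(filterI VF) /filter_ex[x [[i le_in Fx] /(_ i le_in)]].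
by [].
Qed.

(** The pigeonhole principle, read off an ultrafilter containing [B]. *)
Lemma initial_union_infinite (B : set nat) F n : infinite_set B ->
  almost_sub B (initial_union F n) -> exists i, infinite_set (B `&` F i).
Proof.
move=> Binf BF; have [V [UV BV]] := ultrafilter_of_infinite Binf.
have [i Vi] := ultra_initial_union UV (BV _ BF); exists i.
apply: (ultra_infinite UV BV); apply: filterI => //.
exact/BV/subset_almost_sub.
Qed.

Definition sup_cylinders k (F : nat -> set nat) : set (k.-tuple nat) :=
  [set x | initial_union F (head 0 x) (last 0 x)].

Arguments sup_cylinders : clear implicits.

Lemma sup_cylinders_cons k F n (x : k.+1.-tuple nat) :
  sup_cylinders k.+2 F (cons_tuple n x) = cylinder k.+1 (initial_union F n) x.
Proof. by case/tupleP: x. Qed.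

Lemma sup_cylindersP k (F : nat -> set nat) :
  is_sup_mod (NC k.+2) (range (fun i => cylinder k.+2 (F i)))
    (sup_cylinders k.+2 F).
Proof.
split=> [_ [i _ <-]|C FC].
  apply/NCP => B Binf; exists i => n le_in Bn; apply: (box_notin_fin Binf).
  apply: fin_ideal_sub Bn => x Bx; split=> // -[].
  rewrite cylinder_cons => Fx; apply.
  by rewrite sup_cylinders_cons; exists i.
apply: contrapT => /not_NCP[B [Binf Ninf]].
(* A single slice suffices: it puts the last side of [B] almost inside finitely many [F i], and one
   of these gives a nonzero part of its cylinder outside [C]. *)
have [n Bn] := infinite_setN0 Ninf.
have [|i iinf] := @initial_union_infinite (B ord_max) F n (Binf _).
  apply: almost_sub_of_boxD_cylinder => //; apply: fin_ideal_sub Bn => x [Bx nx].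
  by split=> // -[]; rewrite sup_cylinders_cons.
apply: (pos_cylinder Binf Ninf iinf); apply: NC_sub (FC _ (imageP _ (I : setT i))).
by move=> x [[_ nC] Fx]; split.
Qed.

(** If no initial union almost contained the last side, a diagonal [D] inside that side would be
    almost disjoint from all of them. The box with last side [D] would then almost avoid every slice
    of the supremum, while lying almost inside infinitely many slices of [C]. *)
Lemma almost_sub_of_le_sup k (C : set (k.+2.-tuple nat))
    (B : 'I_k.+1 -> set nat) (F : nat -> set nat) :
    (forall i, infinite_set (B i)) ->
    infinite_set [set n | fin_ideal k.+1 (box B `\` slice C n)] ->
    le_mod (NC k.+2) C (sup_cylinders k.+2 F) ->
  exists m, almost_sub (B ord_max) (initial_union F m).
Proof.
move=> Binf Ninf CF; apply: contrapT => nB.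
have [m|D [Dinf DB DF]] :=
    @pseudo_intersection (fun m => B ord_max `\` initial_union F m).
  have BF : infinite_set (B ord_max `\` initial_union F m).
    by move=> Bfin; apply: nB; exists m.
  have [x mx [Bx nF]] := (infinite_natP _).1 BF m.
  exists x => // j jm; split=> // -[i ij Fi]; apply: nF.
  by exists i => //; apply: leq_trans jm.
have /NCP/(_ (set_last B D)) [|m mP] := CF; first exact: set_last_infinite.
have [n /mP + Bn] := (infinite_natP _).1 Ninf m; apply.
have : fin_ideal k.+1 (box (set_last B D) `\` cylinder k.+1 (~` initial_union F n)).
  apply: fin_boxD_cylinder; rewrite set_last_max.
  by apply: sub_finite_set (DF n) => x [? nn]; split=> // -[].
move=> /(fin_idealU Bn); apply: fin_ideal_sub => x [Bx nCx].
have [nF|nF] := pselect (cylinder k.+1 (~` initial_union F n) x); last by right.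
left; split; first by have [|] := box_set_last _ Bx => // y /DB[].
move=> Cx; apply: nCx; split=> //.
by rewrite sup_cylinders_cons.
Qed.

(** The first coordinate bounds which suprema are imposed, the second how many cylinders of each are
    used. *)
Definition inf_sup_cylinders k (F : nat -> nat -> set nat) :
    set (k.-tuple nat) :=
  [set x | forall j, j <= head 0 x ->
     initial_union (F j) (nth 0 x 1) (last 0 x)].

Arguments inf_sup_cylinders : clear implicits.

Lemma inf_sup_cylindersP k (F : nat -> nat -> set nat)
    (X : nat -> set (k.+3.-tuple nat)) :
    (forall j, is_sup_mod (NC k.+3)
      (range (fun i => cylinder k.+3 (F j i))) (X j)) ->
  is_inf_mod (NC k.+3) (range X) (inf_sup_cylinders k.+3 F).
Proof.
move=> FX.
have slice2 n y :
    slice (slice (inf_sup_cylinders k.+3 F) n) y =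
    cylinder k.+1 [set z | forall j, j <= n -> initial_union (F j) y z].
  by apply/funext => x; case/tupleP: x.
split=> [_ [j _ <-]|C CX]; apply: contrapT => /not_NCP[B [Binf Ninf]].
  (* Lower bound: a slice at [n >= j] imposes the condition on [F j]. Slicing again at some [y] in
     the first side leaves a cylinder over a subset of [initial_union (F j) y]. *)
  have [n jn /fin_idealS[m mP]] := (infinite_natP _).1 Ninf j.
  have [y /mP Bny B0y] := (infinite_natP _).1 (Binf ord0) m.
  have lmax : lift ord0 ord_max = ord_max :> 'I_k.+2 by apply/val_inj.
  have [|i iinf] := @initial_union_infinite (B ord_max) (F j) y (Binf _).
    rewrite -lmax.
    apply: (@almost_sub_of_boxD_cylinder k (fun i => B (lift ord0 i))).
      by move=> i.
    apply: fin_ideal_sub Bny => x [Bx nx]; split; first exact/box_cons.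
    move=> [Zx _]; have := Zx : slice (slice _ n) y x.
    by rewrite slice2 => /(_ j jn).
  apply: (pos_cylinder Binf Ninf iinf).
  apply: NC_sub ((FX j).1 _ (imageP _ (I : setT i))).
  by move=> x [[_ nX] Fx]; split.
(* Greatest: suprema are unique only modulo the ideal, so [X j] is first compared with the explicit
   one. *)
have CF j : le_mod (NC k.+3) C (sup_cylinders k.+3 (F j)).
  apply: le_mod_NC_trans (CX _ (imageP _ (I : setT j))) ((FX j).2 _ _) => E.
  exact: (sup_cylindersP _ _).1.
have CN : infinite_set [set n | fin_ideal k.+2 (box B `\` slice C n)].
  apply: sub_infinite_set Ninf => n; apply: fin_ideal_sub => x [Bx nC].
  by split=> // -[].
have [f fP] := choice (fun j => almost_sub_of_le_sup Binf CN (CF j)).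
have [n Bn] := infinite_setN0 Ninf; apply: (box_notin_fin Binf).
have : fin_ideal k.+2 (box B `\` slice (inf_sup_cylinders k.+3 F) n).
  (* The slice at [n] imposes only the conditions [j <= n], so the thresholds [f j], and later
     [g j], have finite maxima. *)
  apply/fin_idealS; exists (\max_(j < n.+1) f j) => y yP.
  apply: fin_slice_boxD => _; rewrite slice2; apply: fin_boxD_cylinder.
  rewrite (_ : lift ord0 ord_max = ord_max); last exact/val_inj.
  have [g gP] := choice (fun j => (almost_subP _ _).1 (fP j)).
  apply/almost_subP; exists (\max_(j < n.+1) g j) => z zP Bz j jn.
  have /= jg := leq_trans (leq_bigmax (Ordinal (jn : j < n.+1))) zP.
  have /= jf := leq_trans (leq_bigmax (Ordinal (jn : j < n.+1))) yP.
  have [i ij Fi] := gP j z jg Bz.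
  by exists i => //; apply: leq_trans jf.
move=> /(fin_idealU Bn); apply: fin_ideal_sub => x Bx.
have [Zx|nZx] := pselect (slice (inf_sup_cylinders k.+3 F) n x).
  by left; split=> // -[].
by right.
Qed.

(** * Enumerations of levels, and branches selected by an ultrafilter *)

Lemma countable_range (U : Type) (S : set U) :
  countable S -> S !=set0 -> exists e : nat -> U, S = range e.
Proof.
move=> /countable_injP[f finj] [s0 Ss0].
(* Numbers that code no element of [S] are sent to [s0]. *)
have ex n : exists s, S s /\ forall t, S t -> f t = n -> s = t.
  have [[t [St <-]]|nt] := pselect (exists t, S t /\ f t = n).
    by exists t; split=> // t' St' ftt'; apply: finj; rewrite ?inE.
  by exists s0; split=> // t St ft; case: nt; exists t.
have [e eP] := choice ex; exists e; apply/seteqP; split=> [t St|_ [n _ <-]].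
  by exists (f t) => //; have [_ ft] := eP (f t); apply: ft.
by have [] := eP n.
Qed.

Lemma ultra_almost_sub (V : set_system nat) (S S' : set nat) : UltraFilter V ->
  (forall S, V S -> infinite_set S) -> V S -> almost_sub S S' -> V S'.
Proof.
move=> UV Vinf VS SS'; case: (in_ultra_setVsetC S' UV) => // /(filterI VS).
by move=> /Vinf /(_ SS').
Qed.

Import Order.TTheory.
Local Open Scope order_scope.
Local Open Scope classical_set_scope.

Section Tree.
Context {d : Order.disp_t} {W : orderType d}.
Variables (T : set (pfun W)) (A : pfun W -> set nat).

Lemma restr_level (a b : W) (s : pfun W) : is_tree T ->
  a <= b -> level T b s -> level T a (restr s a).
Proof.
move=> [_ Tr] ab [Ts sb]; split; first exact: Tr.
apply/seteqP; split=> [c|c ca]; rewrite /dom /seg /restr /=; first by case: ifP.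
rewrite [c < a]ca; have : dom s c by rewrite sb; apply: lt_le_trans ca ab.
by [].
Qed.

Lemma extended_by_restr (s : pfun W) (a : W) : extended_by (restr s a) s.
Proof. by move=> b n; rewrite /restr; case: ifP. Qed.

Lemma omega1_no_max : is_omega1 W -> forall b : W, exists a, b < a.
Proof.
move=> [_ cseg nW] b; apply: contrapT => nb; apply: nW.
apply: (sub_countable (subset_card_le (_ : _ `<=` seg b `|` [set b]))).
  move=> c _; case: (ltgtP c b) => [?|bc|?]; [by left| |by right].
  by case: nb; exists c.
rewrite -bigcup2E; apply: bigcup_countable => // -[|[|i]] _ /=.
- exact: cseg.
- exact: countable1.
- exact: countable0.
Qed.

Lemma ultra_branch (V : set_system nat) : is_omega1 W -> aronszajn T ->
    (forall s t, T s -> T t -> extended_by s t -> almost_sub (A t) (A s)) ->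
    (forall a : W, trivIset (level T a) A) ->
    UltraFilter V -> (forall S, V S -> infinite_set S) ->
  ~ forall a : W, exists s, level T a s /\ V (A s).
Proof.
move=> hW [Ttree _ nobranch] Asub Atriv UV Vinf /choice[s sP].
have uniq a t : level T a t -> V (A t) -> t = s a.
  move=> Lt Vt; have [Ls Vs] := sP a; apply: (Atriv a) => //.
  exact: filter_ex (filterI Vt Vs).
(* The set of the restricted node almost contains one in [V], so it is in [V] too, and uniqueness on
   level [a] applies. *)
have sr a b : a <= b -> restr (s b) a = s a.
  move=> ab; have [Lb Vb] := sP b; have La := restr_level Ttree ab Lb.
  apply: uniq => //; apply: ultra_almost_sub Vb _ => //; apply: Asub.
  - by case: La.
  - by case: Lb.
  - exact: extended_by_restr.
have sE a b c : a < b -> a < c -> s b a = s c a.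
  wlog bc : b c / b <= c => [th ab ac|ab ac].
    by case/orP: (le_total b c) => /th -> //.
  by rewrite -(sr b c bc) /restr ab.
have [next nextP] := choice (omega1_no_max hW).
(* The default [0] is never reached, since [b] lies below [next b] and hence in the domain of
   [s (next b)]. *)
apply: nobranch; exists (fun b => odflt 0%N (s (next b) b)) => a.
suff -> : restr (fun b => Some (odflt 0%N (s (next b) b))) a = s a.
  by have [[]] := sP a.
apply/funext => b; rewrite /restr; have [[_ doma] _] := sP a.
case: ifPn => [ba|nba].
  rewrite (sE b (next b) a) //.
  have : dom (s a) b by rewrite doma.
  by rewrite /dom /=; case: (s a b).
have : ~ dom (s a) b by rewrite doma /seg /=; apply/negP.
by rewrite /dom /=; case: (s a b) => // n; case.
Qed.

End Tree.

(** * The tower of the [X a] and the partition into the [Y a] *)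

Section Levels.
Context {d : Order.disp_t} {W : orderType d}.
Variables (T : set (pfun W)) (A : pfun W -> set nat) (k : nat).
Variable X : W -> set (k.+3.-tuple nat).

Hypothesis hW : is_omega1 W.
Hypothesis hT : aronszajn T.
Hypothesis hAinf : forall s, T s -> infinite_set (A s).
Hypothesis hAsub : forall s t, T s -> T t -> extended_by s t ->
  almost_sub (A t) (A s).
Hypothesis hApart : forall a : W, partition (level T a) A [set: nat].
Hypothesis hX : forall a : W, is_sup_mod (NC k.+3)
  [set cylinder k.+3 (A s) | s in level T a] (X a).

Lemma level_enum (a : W) : exists e : nat -> pfun W, level T a = range e.
Proof. by have [_ /(_ a)[ne ctbl] _] := hT; apply: countable_range. Qed.

Lemma level_cylinders_range (a : W) (e : nat -> pfun W) :
  level T a = range e ->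
  [set cylinder k.+3 (A s) | s in level T a] =
  range (fun i => cylinder k.+3 (A (e i))).
Proof. by move=> ->; rewrite image_comp. Qed.

(** Each cylinder of level [b] is below that of its node restricted to [a]. *)
Lemma X_decr (a b : W) : a <= b -> le_mod (NC k.+3) (X b) (X a).
Proof.
have [Ttree _ _] := hT; move=> ab; apply: (hX b).2 => _ [s Ls <-].
have La := restr_level Ttree ab Ls.
apply: (@le_mod_NC_trans _ _ (cylinder k.+3 (A (restr s a)))).
  apply: cylinder_le_mod; apply: hAsub; [by case: La|by case: Ls|].
  exact: extended_by_restr.
by apply: (hX a).1; exists (restr s a).
Qed.

Lemma X_pos (a : W) : ~ NC k.+3 (X a).
Proof.
have [_ /(_ a)[[s Ls] _] _] := hT; move=> NX.
apply: (@cylinder_pos k.+1 (A s)); first by apply: hAinf; case: Ls.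
have sX : le_mod (NC k.+3) (cylinder k.+3 (A s)) (X a).
  by apply: (hX a).1; exists s.
by apply: NC_sub (NCU sX NX) => x ?; have [|] := pselect (X a x); [right|left].
Qed.

Lemma X_no_lower_bound (P : set (k.+3.-tuple nat)) :
  ~ NC k.+3 P -> ~ forall a, le_mod (NC k.+3) P (X a).
Proof.
move=> /not_NCP[B [Binf Ninf]] PX.
have [V [UV BV]] := ultrafilter_of_infinite (Binf ord_max).
have Vinf := ultra_infinite UV BV.
apply: (ultra_branch hW hT hAsub _ UV Vinf) => [a|a].
  by have [] := hApart a.
have [e eP] := level_enum a.
have PF : le_mod (NC k.+3) P (sup_cylinders k.+3 (fun i => A (e i))).
  apply: le_mod_NC_trans (PX a) ((hX a).2 _ _); rewrite (level_cylinders_range eP).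
  exact: (sup_cylindersP _ _).1.
have [m mP] := almost_sub_of_le_sup Binf Ninf PF.
have [i Vi] := ultra_initial_union UV (BV _ mP).
by exists (e i); split=> //; rewrite eP; exists i.
Qed.

(** The least level contains only the empty function, whose set must be all of [nat]; so [X a] is
    the top element. *)
Lemma le_X_min (a : W) (P : set (k.+3.-tuple nat)) :
  ~ (seg a !=set0) -> le_mod (NC k.+3) P (X a).
Proof.
move=> /set0P/negP; rewrite negbK => /eqP seg0.
have [_ /(_ a)[[s Ls] _] _] := hT; have [cov _ _] := hApart a.
have AsT : A s = setT.
  apply/seteqP; split=> // n _; have : cover (level T a) A n by rewrite cov.
  case=> t [Tt domt]; suff -> : t = s by [].
  have empty (r : pfun W) : dom r = seg a -> r = fun=> None.
    rewrite seg0 => domr; apply/funext => b; apply: contrapT => rb.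
    by have : dom r b by []; rewrite domr.
  by rewrite (empty t domt) (empty s) //; case: Ls.
apply: (@le_mod_NC_trans _ _ (cylinder k.+3 (A s))).
  by apply: subset_le_mod_NC => x _; rewrite AsT.
by apply: (hX a).1; exists s.
Qed.

Lemma X_inf_exists (a : W) : seg a !=set0 ->
  exists Z, is_inf_mod (NC k.+3) [set X b | b in seg a] Z.
Proof.
have [_ cseg _] := hW; move=> /(countable_range (cseg a))[b segb].
have [e eP] := choice level_enum.
exists (inf_sup_cylinders k.+3 (fun j i => A (e (b j) i))).
rewrite segb image_comp; apply: inf_sup_cylindersP => j.
by rewrite -(level_cylinders_range (eP (b j))); apply: hX.
Qed.

Lemma X_tower : is_tower (NC k.+3) (range X).
Proof.
split=> [_ [a _ <-]|G GX [B GB]|[P Ppos PX]].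
- exact: X_pos.
(* As [X] decreases, the least index occurring in [G] gives its largest member. *)
- have [wo _ _] := hW; have [|m Gm mP] := wo [set b | G (X b)].
    by have [a _ aB] := GX B GB; exists a; rewrite /= aB.
  exists (X m) => // C GC; have [c _ cC] := GX C GC; rewrite -cC.
  by apply/X_decr/mP; rewrite /= cC.
- by apply: (X_no_lower_bound Ppos) => a; apply: PX; exists a.
Qed.

Variable Y : W -> set (k.+3.-tuple nat).
Hypothesis hY : forall a : W, seg a !=set0 -> exists2 Z,
  is_inf_mod (NC k.+3) [set X b | b in seg a] Z &
  eq_mod (NC k.+3) (Y a) (Z `\` X a).

(** For [a < b], [Y b] is below [X a] modulo the ideal, while [Y a] is disjoint from [X a]. *)
Lemma Y_disjoint (a b : W) : seg a !=set0 -> seg b !=set0 -> a <> b ->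
  NC k.+3 (Y a `&` Y b).
Proof.
wlog ab : a b / a < b => [th sa sb neq|sa sb _].
  case: (ltgtP a b) => [ab|ba|//]; first exact: th.
  by rewrite setIC; apply: th => // ?; apply: neq.
have [Za _ [Ya _]] := hY sa; have [Zb [Zb_le _] [Yb _]] := hY sb.
have ZX : le_mod (NC k.+3) Zb (X a) by apply: Zb_le; exists a.
apply: NC_sub (NCU Ya (NCU Yb ZX)) => x [Yax Ybx].
have [Xa|nXa] := pselect (X a x); last first.
  by right; have [Zbx|nZbx] := pselect (Zb x);
    [right; split|left; split=> // -[]].
by left; split=> // -[].
Qed.

Lemma Y_maximal (P : set (k.+3.-tuple nat)) :
  (forall a, seg a !=set0 -> NC k.+3 (P `&` Y a)) -> NC k.+3 P.
Proof.
move=> PY; apply: contrapT => Ppos.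
have [wo _ _] := hW.
have [|a nPa amin] := wo [set a | ~ le_mod (NC k.+3) P (X a)].
  apply: contrapT => ne; apply: (X_no_lower_bound Ppos) => a.
  by apply: contrapT => nPa; apply: ne; exists a.
have [sa|nsa] := pselect (seg a !=set0); last exact/nPa/le_X_min.
have [Z [_ Zglb] [_ ZY]] := hY sa.
have PZ : le_mod (NC k.+3) P Z.
  apply: Zglb => _ [b ba <-]; apply: contrapT => /amin.
  by rewrite leNgt ba.
apply: nPa; apply: NC_sub (NCU PZ (NCU ZY (PY a sa))) => x [Px nX].
have [Zx|nZx] := pselect (Z x); last by left.
by right; have [Yx|nYx] := pselect (Y a x); [right|left].
Qed.

Lemma Y_partition : is_partition_mod (NC k.+3) [set a | seg a !=set0] Y.
Proof.
split; first exact: Y_disjoint.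
split.
  split=> [_ [a [_ Ya] <-] //|_ _ [a [sa _] <-] [b [sb _] <-] neq].
  by apply: Y_disjoint => // ab; apply: neq; rewrite ab.
move=> G [Gpos Gad] YG; apply/seteqP; split=> // P GP.
(* A member of [G] outside the family would meet every [Y a] in a null set, including those [Y a]
   that are null themselves. *)
apply: contrapT => nP; apply: (Gpos P GP); apply: Y_maximal => a sa.
have [NYa|Ya] := pselect (NC k.+3 (Y a)).
  by apply: NC_sub NYa => x [].
have YaF : [set Y a | a in [set a | seg a !=set0 /\ ~ NC k.+3 (Y a)]] (Y a).
  by exists a.
by apply: Gad => // [|PE]; [exact: YG|apply: nP; rewrite PE].
Qed.

End Levels.

Theorem theorem3p8 (d : Order.disp_t) (W : orderType d) (hW : is_omega1 W)
    (T : set (pfun W)) (hT : aronszajn T)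
    (A : pfun W -> set nat)
    (hAinf : forall s, T s -> infinite_set (A s))
    (hAsub : forall s t, T s -> T t -> extended_by s t ->
       almost_sub (A t) (A s))
    (hApart : forall a : W, partition (level T a) A [set: nat])
    (k : nat) (hk : (3 <= k)%N) :
  (forall a : W, exists S : set (k.-tuple nat),
     is_sup_mod (NC k) [set cylinder k (A s) | s in level T a] S) /\
  forall X : W -> set (k.-tuple nat),
    (forall a : W,
       is_sup_mod (NC k) [set cylinder k (A s) | s in level T a] (X a)) ->
    (forall a : W, seg a !=set0 -> exists Z : set (k.-tuple nat),
       is_inf_mod (NC k) [set X b | b in seg a] Z) /\
    is_tower (NC k) [set X a | a in [set: W]] /\
    forall Y : W -> set (k.-tuple nat),
      (forall a : W, seg a !=set0 -> exists2 Z : set (k.-tuple nat),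
         is_inf_mod (NC k) [set X b | b in seg a] Z &
         eq_mod (NC k) (Y a) (Z `\` X a)) ->
      is_partition_mod (NC k) [set a : W | seg a !=set0] Y.
Proof.
case: k hk => [|[|[|k]]] // _; split=> [a|X hX].
  have [e eP] := level_enum hT a; exists (sup_cylinders k.+3 (fun i => A (e i))).
  by rewrite (level_cylinders_range A k eP); apply: sup_cylindersP.
split; first exact: (X_inf_exists hW hT hX).
split; first exact: (X_tower hW hT hAinf hAsub hApart hX).
by move=> Y hY; apply: (Y_partition hW hT hAsub hApart hX hY).
Qed.
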